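(* Let $A$ be a connected $N$-dimensional Adinkra with code $C\subseteq \mathbb{F}_2^N$ of dimension $k$. Let $\mathcal{H}$ be its signed monodromy group, $\mathcal{M}$ its monodromy group, and $\Sigma$ the kernel of the homomorphism $\mathrm{abs}:\mathcal{H}\to\mathcal{M}$. Let $h_1=11\cdots 1\in\mathbb{F}_2^N$ be the word of all ones. The groups $\mathcal{H}$ and $\Sigma$ depend on whether $h_1\in C$ or not: \begin{itemize} \item If $h_1\notin C$, then $\mathcal{H}\cong G_{N-1}$ and $\Sigma\cong \mathbb{F}_2^{k+1}$. \item If $h_1\in C$, then $\mathcal{H}\cong G_{N-2}$ and $\Sigma\cong \mathbb{F}_2^{k}$. \end{itemize} Here the isomorphisms are of groups, $G_n$ is the Salingaros Vee group, and $\mathbb{F}_2^m$ is regarded as an additive group.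
   Context: Adinkra: an $N$-dimensional Adinkra is a finite bipartite graph with vertices divided into bosons and fermions (every edge joins a boson and a fermion), whose edges are coloured by $1,\dots,N$ so that each vertex is incident with exactly one edge of each colour and, for any two distinct colours, the edges of these two colours form a disjoint union of 4-cycles; together with an odd dashing (each edge is solid or dashed, and each such 2-coloured 4-cycle has an odd number of dashed edges) and a height assignment (an integer-valued ranking of the vertices, which plays no role here). It is connected if the graph is. $F$ denotes the set of fermions. Code: for each colour $i$, moving along the edge of colour $i$ is an involution of the vertex set; these involutions commute, so $\mathbb{F}_2^N$ acts on the vertices, transitively if the Adinkra is connected. The code $C$ of a connected Adinkra is the stabilizer of any vertex, so the underlying coloured graph is the quotient of the $N$-cube $\mathbb{F}_2^N$ by $C$. It is known that $C$ is a doubly even linear code (every element has a number of ones divisible by 4). $k=\dim_{\mathbb{F}_2} C$. Monodromy: for $j=1,\dots,N-1$ let $\sigma_j:F\to F$ be the permutation sending a fermion to the endpoint of the path that follows the edge of colour $j+1$ and then the edge of colour $1$. The monodromy group $\mathcal{M}$ is the permutation group generated by $\sigma_1,\dots,\sigma_{N-1}$ (it is the monodromy group, acting on the fibre $F$ over $\infty$, of the branched cover of $\mathbb{CP}^1$ associated with the Adinkra and the cyclic order of colours). Signed monodromy: let $\pm F=F\sqcup -F$, where $-F$ is a disjoint copy of $F$, with the involution $x\mapsto -x$. A signed permutation of $\pm F$ is a bijection $f$ with $f(-x)=-f(x)$. For $j=1,\dots,N-1$ let $\zeta_j$ be the signed permutation with $\zeta_j(x)=(-1)^s\sigma_j(x)$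 for $x\in F$, where $s$ is the number of dashed edges in the path from $x$ following colour $j+1$ and then colour $1$. The signed monodromy group $\mathcal{H}$ is the group generated by $\zeta_1,\dots,\zeta_{N-1}$. The map $\mathrm{abs}$ sends a signed permutation of $\pm F$ to the induced permutation of the set of pairs $\{x,-x\}$, which is identified with $F$; it restricts to a homomorphism $\mathcal{H}\to\mathcal{M}$. Salingaros Vee group: $G_n=\langle -1,g_1,\dots,g_n \mid (-1)^2=1,\ g_i^2=-1,\ g_ig_j=(-1)g_jg_i\ (i\ne j),\ (-1)g_i=g_i(-1)\rangle$, where $-1$ is the name of a generator.
   Formalization: The formal theorem assumes N ≥ 2: for N = 1 the claim is false (the signed monodromy group is trivial while G_0 has order 2), and for N = 0 there is no colour 1 and G_{-2} is undefined. *)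

(* Defs.v *)
From HB Require Import structures.
From mathcomp Require Import all_boot all_order all_algebra all_fingroup.
From mathcomp Require Import boolp.

Set Implicit Arguments.
Unset Strict Implicit.
Unset Printing Implicit Defensive.

Import GroupScope GRing.Theory FinRing.Theory.
Local Open Scope group_scope.

(* [edge i x y]: an edge of colour [i] joins [x] and [y].  By [four_cycles] and
   [edge_uniq] two vertices are joined by at most one edge, so the dashing can
   be given on pairs of vertices.  In [four_cycles], since every vertex has
   exactly one edge of each colour, the displayed cycle is the whole connected
   component of [v] in the subgraph of colours [i] and [j]. *)
Record adinkra (N : nat) := Adinkra {
  vertex : finType;
  boson : pred vertex;
  edge : 'I_N -> rel vertex;
  dashed : rel vertex;
  height : vertex -> int;
  edge_sym : forall i, symmetric (edge i);
  edge_bipartite : forall i x y, edge i x y -> boson x != boson y;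
  edge_uniq : forall i x, exists! y, edge i x y;
  four_cycles : forall i j, i != j -> forall v, exists w x y,
    [/\ uniq [:: v; w; x; y], edge i v w, edge j w x, edge i x y & edge j y v];
  dashed_sym : forall i x y, edge i x y -> dashed x y = dashed y x;
  odd_dashing : forall i j v w x y, i != j ->
    edge i v w -> edge j w x -> edge i x y -> edge j y v ->
    odd (dashed v w + dashed w x + dashed x y + dashed y v)
}.

Definition connected N (A : adinkra N) :=
  forall x y : vertex A, connect [rel u v | [exists i, edge i u v]] x y.

Section Colours.
Variables (N : nat) (A : adinkra N).
Implicit Types (i j : 'I_N) (x y v : vertex A).

Definition nbr i x : vertex A := odflt x [pick y | edge i x y].

Lemma nbrP i x : edge i x (nbr i x).
Proof.
rewrite /nbr; case: pickP => //= e0.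
by have [y [exy _]] := edge_uniq i x; rewrite e0 in exy.
Qed.

Lemma nbr_eq i x y : edge i x y -> nbr i x = y.
Proof.
move=> exy; have [z [_ uz]] := edge_uniq i x.
by rewrite -(uz _ exy) -(uz _ (nbrP i x)).
Qed.

Lemma nbrK i : involutive (nbr i).
Proof. by move=> x; apply: nbr_eq; rewrite edge_sym nbrP. Qed.

Lemma nbrC i j x : nbr i (nbr j x) = nbr j (nbr i x).
Proof.
have [->//|ij] := eqVneq i j.
have [w [z [y [_ e1 e2 e3 e4]]]] := four_cycles ij x.
rewrite (nbr_eq e1) (nbr_eq e2) (@nbr_eq j x y) 1?edge_sym //.
by apply: nbr_eq; rewrite edge_sym.
Qed.

Lemma boson_nbr i x : boson (nbr i x) = ~~ boson x.
Proof. by move: (edge_bipartite (nbrP i x)); case: boson; case: boson. Qed.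

Definition step i : {perm vertex A} := perm (can_inj (@nbrK i)).

Definition walk (w : 'rV['F_2]_N) : {perm vertex A} :=
  \prod_(i < N) step i ^+ (w 0%R i).

Lemma stepC i j : commute (step i) (step j).
Proof. by apply/permP=> x; rewrite !permM !permE nbrC. Qed.

Lemma step2 i : step i ^+ 2 = 1.
Proof. by apply/permP=> x; rewrite expgS expg1 permM !permE nbrK. Qed.

(* The group law of ['rV['F_2]_N] is vector addition. *)
Lemma walkM : {morph walk : u w / u * w}.
Proof.
move=> u w; rewrite /walk -prodgM_commute; last first.
  by move=> i j _ _; apply: commuteX2; apply: stepC.
apply: eq_bigr => i _; rewrite -expgD zmodMgE mxE.
by rewrite -[RHS](expg_mod _ (step2 i)).
Qed.

Lemma walk1 : walk 1%g = 1.
Proof. by rewrite /walk big1 // => i _; rewrite zmod1gE mxE. Qed.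

Definition cube_act x (w : 'rV['F_2]_N) : vertex A := walk w x.

Lemma cube_act1 : cube_act^~ 1%g =1 id.
Proof. by move=> x; rewrite /cube_act walk1 perm1. Qed.

Lemma cube_actM x : act_morph cube_act x.
Proof. by move=> u w; rewrite /cube_act walkM permM. Qed.

Canonical cube_action := TotalAction cube_act1 cube_actM.

(* The stabiliser is closed under addition, hence equal to its linear span
   over ['F_2]; see [mem_code]. *)
Definition code v : {vspace 'rV['F_2]_N} := <<enum 'C[v | cube_action]>>%VS.

Lemma mem_code v w : (w \in code v) = (w \in 'C[v | cube_action]).
Proof.
apply/idP/idP => [|Cw]; last by apply: memv_span; rewrite mem_enum.
move=> /(@coord_span _ _ _ (in_tuple _)) ->.
elim/big_ind: _ => [|u u' Cu Cu'|i _].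
- exact: (group1 'C[v | cube_action]).
- exact: (groupM (G := 'C[v | cube_action]%G) Cu Cu').
have: (in_tuple (enum 'C[v | cube_action]))`_i%R \in 'C[v | cube_action].
  by rewrite -mem_enum mem_nth //= ltn_ord.
set c := coord _ _ _; case: c => [[|[|//]] c_lt] Cu.
  rewrite (_ : Ordinal c_lt = 0%R) ?scale0r; last exact: val_inj.
  exact: (group1 'C[v | cube_action]).
by rewrite (_ : Ordinal c_lt = 1%R) ?scale1r //; apply: val_inj.
Qed.

End Colours.

(* Colours are numbered from 0 and [j : 'I_N.-1] stands for the index [j + 1]
   in 1, ..., N - 1; such a [j] exists only when [1 < N]. *)
Definition first_colour N (j : 'I_N.-1) : 'I_N :=
  Ordinal (leq_trans (leq_ltn_trans (leq0n j) (ltn_ord j)) (leq_pred N)).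

Lemma next_colour_subproof N (j : 'I_N.-1) : j.+1 < N.
Proof. by case: N j => [|n] [j lt_j]. Qed.

Definition next_colour N (j : 'I_N.-1) : 'I_N :=
  Ordinal (next_colour_subproof j).

Section Monodromy.
Variables (N : nat) (A : adinkra N).
Implicit Type j : 'I_N.-1.

Definition fermion : finType := {x : vertex A | ~~ boson x}.

Lemma sigma_subproof j (x : fermion) :
  ~~ boson (nbr (first_colour j) (nbr (next_colour j) (val x))).
Proof. by rewrite !boson_nbr negbK (valP x). Qed.

Definition sigma_fun j (x : fermion) : fermion :=
  exist _ (nbr (first_colour j) (nbr (next_colour j) (val x)))
    (sigma_subproof j x).

Lemma sigma_inj j : injective (sigma_fun j).
Proof.
move=> x y /(congr1 val) /= /(can_inj (@nbrK _ _ _)).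
by move=> /(can_inj (@nbrK _ _ _)) /val_inj.
Qed.

Definition sigma j : {perm fermion} := perm (@sigma_inj j).

Definition monodromy : {group {perm fermion}} :=
  <<[set sigma j | j : 'I_N.-1]>>%G.

(* [(false, x)] is [x] and [(true, x)] is [- x]. *)
Definition pm_fermion : finType := (bool * fermion)%type.

Definition pm_opp (u : pm_fermion) : pm_fermion := (~~ u.1, u.2).

Definition signed_perm : {set {perm pm_fermion}} :=
  [set f : {perm pm_fermion} | [forall u, f (pm_opp u) == pm_opp (f u)]].

Lemma signed_permP (f : {perm pm_fermion}) :
  reflect (forall u, f (pm_opp u) = pm_opp (f u)) (f \in signed_perm).
Proof. by rewrite inE; apply: (iffP forallP) => h u; apply/eqP/h. Qed.

Lemma signed_perm_group_set : group_set signed_perm.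
Proof.
apply/group_setP; split=> [|f g /signed_permP hf /signed_permP hg].
  by apply/signed_permP=> u; rewrite !perm1.
by apply/signed_permP=> u; rewrite !permM hf hg.
Qed.

Canonical signed_perm_group := group signed_perm_group_set.

Definition num_dashed j (x : fermion) : nat :=
  let y := nbr (next_colour j) (val x) in
  dashed (val x) y + dashed y (nbr (first_colour j) y).

Definition zeta_fun j (u : pm_fermion) : pm_fermion :=
  (u.1 (+) odd (num_dashed j u.2), sigma j u.2).

Lemma zeta_inj j : injective (zeta_fun j).
Proof.
by move=> [b x] [c y] [/= + /perm_inj exy]; rewrite exy => /addIb ->.
Qed.

Definition zeta j : {perm pm_fermion} := perm (@zeta_inj j).

Definition signed_monodromy : {group {perm pm_fermion}} :=
  <<[set zeta j | j : 'I_N.-1]>>%G.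

(* The pair [{x, - x}] is identified with [x].  The default value [1] is never
   used on signed permutations, see [absE]. *)
Definition abs (f : {perm pm_fermion}) : {perm fermion} :=
  insubd (1 : {perm fermion}) [ffun x : fermion => (f (false, x)).2].

Lemma absE f x : f \in signed_perm -> abs f x = (f (false, x)).2.
Proof.
move=> /signed_permP hf; rewrite /abs.
have inj_f : injectiveb [ffun y : fermion => (f (false, y)).2].
  apply/injectiveP=> y z; rewrite !ffunE => eyz.
  have: f (false, y) = f (false, z) \/ f (false, y) = pm_opp (f (false, z)).
    rewrite /pm_opp; move: eyz.
    case: (f (false, y)) (f (false, z)) => [[] a] [[] b] /= ->; by [left|right].
  by rewrite -hf => -[] /perm_inj [].
by rewrite -pvalE -[pval _]/(val _) val_insubd inj_f ffunE.
Qed.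

Lemma absM : {in signed_perm &, {morph abs : f g / f * g}}.
Proof.
move=> f g Sf Sg; apply/permP=> x; rewrite permM !absE ?groupM // permM.
case: (f (false, x)) => [[] y] //=.
move/signed_permP: Sg => /(_ (false, y)) /=.
by rewrite /pm_opp /= => ->.
Qed.

Canonical abs_morphism := Morphism absM.

Lemma zeta_signed j : zeta j \in signed_perm.
Proof. by apply/signed_permP=> u; rewrite !permE /zeta_fun /pm_opp /= addNb. Qed.

Lemma signed_monodromy_sub : signed_monodromy \subset signed_perm.
Proof. by rewrite gen_subG; apply/subsetP=> _ /imsetP[j _ ->]; apply: zeta_signed. Qed.

Lemma abs_zeta j : abs (zeta j) = sigma j.
Proof. by apply/permP=> x; rewrite absE ?zeta_signed // [zeta j _]permE. Qed.

Lemma abs_signed_monodromy : abs @* signed_monodromy = monodromy.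
Proof.
have sub : [set zeta j | j : 'I_N.-1] \subset signed_perm.
  by apply/subsetP=> _ /imsetP[j _ ->]; apply: zeta_signed.
rewrite morphim_gen // morphimEsub // -imset_comp /=.
by congr <<_>>; apply: eq_imset => j /=; rewrite abs_zeta.
Qed.

Definition abs_kernel : {group {perm pm_fermion}} :=
  'ker_signed_monodromy abs_morphism.

End Monodromy.

(* [(false, a)] is the generator [a] and [(true, a)] its formal inverse. *)
Definition word (I : Type) := seq (bool * I).

HB.instance Definition _ (I : choiceType) := Choice.on (word I).

Definition formal_inv I (w : word I) : word I :=
  rev [seq (~~ l.1, l.2) | l <- w].

Inductive pres_eq I (rel : word I -> word I -> Prop) : word I -> word I -> Prop :=
| pres_rel u v of rel u v : pres_eq rel u v
| pres_inv l : pres_eq rel [:: l; (~~ l.1, l.2)] [::]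
| pres_cat u v u' v' of pres_eq rel u v & pres_eq rel u' v' :
    pres_eq rel (u ++ u') (v ++ v')
| pres_refl u : pres_eq rel u u
| pres_sym u v of pres_eq rel u v : pres_eq rel v u
| pres_trans u v w of pres_eq rel u v & pres_eq rel v w : pres_eq rel u w.

Section Presented.
Variables (I : choiceType) (rel : word I -> word I -> Prop).
Implicit Types u v w : word I.

Definition pres_eqb u v : bool := `[< pres_eq rel u v >].

Lemma pres_eqb_equiv : equiv_class_of pres_eqb.
Proof.
split=> [u|u v|v u w].
- by apply/asboolP; apply: pres_refl.
- by apply/asboolP/asboolP; apply: pres_sym.
- by move=> /asboolP h1 /asboolP h2; apply/asboolP; apply: pres_trans h1 h2.
Qed.

Canonical pres_equiv := EquivRelPack pres_eqb_equiv.

(* Words over the generators and their formal inverses, modulo the least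
   congruence containing the relations and [l l^-1 = 1]. *)
Definition presented := {eq_quot pres_equiv}%qT.

Local Notation qrepr := generic_quotient.repr.

HB.instance Definition _ := Choice.on presented.

Definition pres_class w : presented := (\pi_presented w)%qT.

Lemma pres_classP u v : pres_class u = pres_class v <-> pres_eq rel u v.
Proof. by split=> [/eqmodP/asboolP|h]; last apply/eqmodP/asboolP. Qed.

Lemma pres_ind (P : presented -> Prop) :
  (forall w, P (pres_class w)) -> forall x, P x.
Proof. by move=> h x; rewrite -[x]reprK; apply: h. Qed.

Definition pres_one : presented := pres_class [::].
Definition pres_mul (x y : presented) : presented :=
  pres_class (qrepr x ++ qrepr y).
Definition pres_invg (x : presented) : presented :=
  pres_class (formal_inv (qrepr x)).

Lemma pres_repr w : pres_eq rel (qrepr (pres_class w)) w.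
Proof. by apply/pres_classP; apply: reprK. Qed.

Lemma pres_mulE u v :
  pres_mul (pres_class u) (pres_class v) = pres_class (u ++ v).
Proof. by apply/pres_classP; apply: pres_cat; apply: pres_repr. Qed.

Lemma formal_invK : involutive (@formal_inv I).
Proof.
move=> w; rewrite /formal_inv map_rev revK -map_comp map_id_in // => -[b a] _.
by rewrite /= negbK.
Qed.

Lemma pres_mulV w : pres_eq rel (w ++ formal_inv w) [::].
Proof.
elim: w => [|l w IHw] /=; first exact: pres_refl.
rewrite /formal_inv /= rev_cons -cats1 catA -cat1s.
apply: pres_trans (pres_inv rel l); rewrite -[X in pres_eq _ _ X]cat1s.
apply: (pres_cat (u := [:: l]) (v := [:: l])); first exact: pres_refl.
rewrite -[X in pres_eq _ _ X]cat0s.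
by apply: pres_cat; [exact: IHw | exact: pres_refl].
Qed.

Lemma pres_mulgA : associative pres_mul.
Proof.
elim/pres_ind=> u; elim/pres_ind=> v; elim/pres_ind=> w.
by rewrite !pres_mulE catA.
Qed.

Lemma pres_mul1g : left_id pres_one pres_mul.
Proof. by elim/pres_ind=> u; rewrite pres_mulE. Qed.

Lemma pres_mulg1 : right_id pres_one pres_mul.
Proof. by elim/pres_ind=> u; rewrite pres_mulE cats0. Qed.

Lemma pres_mulgV : right_inverse pres_one pres_invg pres_mul.
Proof.
move=> x; rewrite -{1}[x]reprK /pres_invg.
by rewrite [LHS](pres_mulE (qrepr x)); apply/pres_classP; apply: pres_mulV.
Qed.

Lemma pres_mulVg : left_inverse pres_one pres_invg pres_mul.
Proof.
move=> x; rewrite -{2}[x]reprK /pres_invg.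
rewrite [LHS](pres_mulE _ (qrepr x)); apply/pres_classP.
by rewrite -{2}[qrepr x]formal_invK; apply: pres_mulV.
Qed.

HB.instance Definition _ := isGroup.Build presented
  pres_mulgA pres_mul1g pres_mulg1 pres_mulVg pres_mulgV.

End Presented.

(* [isog] compares two finite groups; here [G] is not known to be finite. *)
Definition isomorphic_to (G : groupType) (gT : finGroupType) (H : {group gT}) :=
  exists f : G -> gT,
    [/\ {morph f : x y / x * y}, injective f
      & forall y, y \in H <-> exists x, f x = y].

Section Vee.
Variable n : nat.

(* [None] is the generator called [-1] and [Some i] is [g_(i + 1)]. *)
Definition vee_m1 : bool * option 'I_n := (false, None).
Definition vee_g (i : 'I_n) : bool * option 'I_n := (false, Some i).

Inductive vee_rel : word (option 'I_n) -> word (option 'I_n) -> Prop :=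
| vee_m1_sq : vee_rel [:: vee_m1; vee_m1] [::]
| vee_g_sq i : vee_rel [:: vee_g i; vee_g i] [:: vee_m1]
| vee_gC i j of i != j :
    vee_rel [:: vee_g i; vee_g j] [:: vee_m1; vee_g j; vee_g i]
| vee_m1C i : vee_rel [:: vee_m1; vee_g i] [:: vee_g i; vee_m1].

Definition vee : groupType := presented vee_rel.

End Vee.

(* Main.v *)
Require Import Defs.
From HB Require Import structures.
From mathcomp Require Import all_boot all_order all_algebra all_fingroup.
From mathcomp Require Import abelian mxabelem.

Set Implicit Arguments.
Unset Strict Implicit.
Unset Printing Implicit Defensive.

(** Put the colours 0, ..., N - 1 and let [signed_step i] be the permutation
    of [{+1, -1} x V] that follows the edge of colour [i] and changes sign if
    this edge is dashed. Then [signed_step i] is an involution, and odd dashing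
    says exactly that [signed_step i] and [signed_step k] anticommute for
    [i != k] ([signed_stepC]). The generator [zeta j] is the restriction to
    the fermions of the product of two such steps, so that the [zeta j] square
    to -1 and anticommute: together with -1 they satisfy the relations of the
    Salingaros Vee group ([zeta_vee_family]).

    In any group, an element of the subgroup generated by such a family is, up
    to sign, the product of the generators over a subset [S] of the indices
    ([gprod_canonical]). A product over a nonempty [S] which equals +1 or -1
    would be central. But a product of even positive length anticommutes with
    each of its factors, and one of odd length anticommutes with each generator
    it omits; so the only possible exception is the product of all generators
    when their number is odd ([gprod_central]). If that exception does not
    occur, the generated group is the Vee group and has order [2 ^ n.+1]
    ([vee_isom], [card_vee_family]).

    For the N - 1 generators [zeta j], N even, the product of all [sigma j]
    follows every colour an odd number of times, so it is the walk along the
    word of all ones ([gprod_sigma_walk]). If this word is not in the code, the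
    exception is excluded and the signed monodromy group is the Vee group on
    N - 1 generators. If it is in the code, then N is even because edges
    alternate between bosons and fermions, the product of all [zeta j] is
    central and fixes every fermion up to sign, and by transitivity of the
    monodromy this sign is constant ([signed_monodromy_cent]). So one generator
    is, up to sign, a product of the others, and the remaining N - 2, an even
    number, admit no exception.

    Elements of the kernel of [abs] only change signs, hence the kernel is an
    elementary abelian 2-group and is determined by its order, the quotient of
    the orders of the signed monodromy and monodromy groups. The monodromy
    group is abelian and transitive on fermions, hence regular, and fermions
    are half of the [2 ^ (N - k)] vertices. *)

(** * Groups generated by anticommuting square roots of a central involution *)

Section VeeFamilies.
Local Open Scope group_scope.

(** The defining relations of the Vee group, with [z] in the role of -1, in an
    arbitrary group: they hold both in the presented group and, as shown below,
    in the signed monodromy group. *)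
Record vee_family (gT : groupType) n (z : gT) (g : 'I_n -> gT) : Prop := {
  fam_zz : z * z = 1;
  fam_gg : forall i, g i * g i = z;
  fam_gC : forall i j, i != j -> g i * g j = z * (g j * g i);
  fam_zC : forall i, commute z (g i) }.

(** The factors do not commute, so the order of the sequence matters; a set of
    indices is represented by its enumeration. *)
Definition gprod (gT : groupType) n (g : 'I_n -> gT) (s : seq 'I_n) : gT :=
  \prod_(i <- s) g i.

Section Words.
Variables (gT : groupType) (n : nat) (z : gT) (g : 'I_n -> gT).
Hypothesis gV : vee_family z g.
Implicit Types (i j : 'I_n) (s t : seq 'I_n) (S T : {set 'I_n}).

Lemma gprod_cons i s : gprod g (i :: s) = g i * gprod g s.
Proof. exact: big_cons. Qed.

Lemma gprod_cat s t : gprod g (s ++ t) = gprod g s * gprod g t.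
Proof. exact: big_cat. Qed.

Lemma fam_zX_odd e : z ^+ e = z ^+ odd e.
Proof.
rewrite -{1}(odd_double_half e) addnC expgnDr -mul2n expgnA expg2 (fam_zz gV).
by rewrite expg1n mul1g.
Qed.

Lemma fam_zV : z^-1 = z.
Proof. by apply: mulg1_eq; apply: fam_zz gV. Qed.

Lemma fam_zXV e : (z ^+ e)^-1 = z ^+ e.
Proof. by rewrite -expVgn fam_zV. Qed.

Lemma fam_gV i : (g i)^-1 = z * g i.
Proof.
apply: mulg1_eq; rewrite mulgA -(fam_zC gV i) -mulgA (fam_gg gV).
exact: fam_zz gV.
Qed.

Lemma fam_zXCA i e x : g i * (z ^+ e * x) = z ^+ e * (g i * x).
Proof. by rewrite !mulgA (commuteX e (commute_sym (fam_zC gV i))). Qed.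

(** Moving [g i] through the product costs one sign for each factor different
    from [g i]. *)
Lemma gprodC i s :
  g i * gprod g s = z ^+ count (predC1 i) s * (gprod g s * g i).
Proof.
elim: s => [|j s IHs]; first by rewrite /gprod big_nil !mul1g mulg1.
rewrite gprod_cons /= -!mulgA; have [->|ne_ji] /= := eqVneq j i.
  by rewrite IHs fam_zXCA.
rewrite add1n expgS mulgA (fam_gC gV) 1?eq_sym // -!mulgA IHs fam_zXCA.
by rewrite mulgA.
Qed.

Lemma gprod_rem i s : i \in s ->
  exists e, gprod g s = z ^+ e * (g i * gprod g (rem i s)).
Proof.
elim: s => //= j s IHs; rewrite inE eq_sym gprod_cons.
have [->|ne_ji] /= := eqVneq j i; first by exists 0; rewrite mul1g.
case/IHs=> e ->; exists e.+1; rewrite gprod_cons fam_zXCA expgSr -mulgA.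
by congr (_ * _); rewrite mulgA (fam_gC gV ne_ji) !mulgA.
Qed.

Lemma gprod_enumD1 i S : i \in S ->
  exists e, gprod g (enum S) = z ^+ e * (g i * gprod g (enum (S :\ i))).
Proof.
rewrite -mem_enum => /gprod_rem[e ->]; exists e.
congr (_ * (_ * gprod g _)); rewrite rem_filter ?enum_uniq // -filter_predI.
by apply: eq_filter => j; rewrite /= !inE.
Qed.

(** Modulo [z] the generators commute and have square 1, so only the parity of
    the number of occurrences of each index survives. *)
Definition odd_support s : {set 'I_n} := [set i | odd (count_mem i s)].

(** Every product of generators is a sign times the product over a set: by
    induction on the sequence, a new factor either cancels against an equal one
    (at the cost of [g i * g i = z]) or is inserted at its place. *)
Lemma gprod_canonical s :
  exists e, gprod g s = z ^+ e * gprod g (enum (odd_support s)).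
Proof.
elim: s => [|i s [e IHs]].
  exists 0; rewrite expg0 mul1g; congr gprod.
  by rewrite -[LHS](enum_set0 'I_n); apply: eq_enum => i; rewrite !inE.
rewrite gprod_cons IHs fam_zXCA.
have [iS | iS] := boolP (i \in odd_support s).
  have [f ->] := gprod_enumD1 iS; rewrite fam_zXCA mulgA -expgnDr.
  rewrite [g i * (g i * _)]mulgA (fam_gg gV) mulgA -expgSr.
  exists (e + f).+1; congr (_ * gprod g _); apply: eq_enum => j.
  move: iS; rewrite !inE /= oddD.
  by case: (eqVneq i j) => [->|] //= ->.
have [f def_gi] := gprod_enumD1 (setU11 i (odd_support s)).
exists (e + f).
have -> : gprod g (enum (odd_support (i :: s))) =
          gprod g (enum (i |: odd_support s)).
  congr gprod; apply: eq_enum => j; move: iS; rewrite !inE /= oddD.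
  by case: (eqVneq i j) => [->|] //= /negPf->.
rewrite def_gi setU1K // [RHS]mulgA -expgnDr -addnA addnn -mul2n; congr (_ * _).
by rewrite expgnDr expgnA expg2 (fam_zz gV) expg1n mulg1.
Qed.

(** If the product over [S] is a power of [z], it commutes with every [g i], so
    by [gprodC] the number of elements of [S] other than [i] is even. Hence
    membership of [i] in [S] is the parity of [#|S|], the same for all [i]. *)
Lemma gprod_central e S : z != 1 -> gprod g (enum S) = z ^+ e ->
  S = set0 \/ odd #|S| /\ S = setT.
Proof.
move=> z1 pz; have odd_even i : ~~ odd (count (predC1 i) (enum S)).
  have := gprodC i (enum S); rewrite pz (fam_zX_odd (count _ _)).
  case: odd => //=.
  rewrite expg1 (commuteX e (commute_sym (fam_zC gV i))) -[LHS]mul1g.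
  by move/mulIg=> z_1; rewrite -z_1 eqxx in z1.
have count_notS i : count (predC1 i) (enum S) + (i \in S) = #|S|.
  rewrite cardE -(count_predC (pred1 i) (enum S)) addnC; congr (_ + _).
  by rewrite count_uniq_mem ?enum_uniq // mem_enum.
have odd_S i : odd #|S| = (i \in S).
  by rewrite -(count_notS i) oddD (negPf (odd_even i)); case: (i \in S).
case oS: (odd #|S|); [right; split=> // | left]; apply/setP=> i.
  by rewrite -odd_S inE.
by rewrite -odd_S inE.
Qed.

End Words.

(** * Recognising the Vee group *)

Section Presentation.
Variables (n : nat).

Local Notation zv := (pres_class (@vee_rel n) [:: vee_m1 n] : vee n).
Local Notation gv := (fun i => pres_class (@vee_rel n) [:: vee_g i] : vee n).

Lemma vee_mulE u w :
  (pres_class (@vee_rel n) u * pres_class (@vee_rel n) w : vee n) =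
  pres_class (@vee_rel n) (u ++ w).
Proof. exact: pres_mulE. Qed.

Lemma vee_family_vee : vee_family zv gv.
Proof.
split=> [|i|i j ne_ij|i].
- by rewrite vee_mulE; apply/pres_classP/pres_rel/vee_m1_sq.
- by rewrite vee_mulE; apply/pres_classP/pres_rel/vee_g_sq.
- rewrite (vee_mulE [:: vee_g j]) !vee_mulE.
  by apply/pres_classP/pres_rel/vee_gC.
by rewrite /commute !vee_mulE; apply/pres_classP/pres_rel/vee_m1C.
Qed.

Definition vee_letter : option 'I_n -> vee n := oapp gv zv.

Lemma vee_one : pres_class (@vee_rel n) [::] = 1 :> vee n.
Proof. by []. Qed.

Lemma vee_class_letters (w : word (option 'I_n)) :
  (pres_class (@vee_rel n) w : vee n) =
  \prod_(l <- w) (if l.1 then (vee_letter l.2)^-1 else vee_letter l.2).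
Proof.
elim: w => [|[b o] w IHw]; first by rewrite big_nil.
rewrite big_cons -IHw -cat1s -vee_mulE; congr (_ * _) => {w IHw}.
have dir : pres_class (@vee_rel n) [:: (false, o)] = vee_letter o by case: o.
case: b => //=; rewrite -dir; symmetry; apply: mulg1_eq; rewrite vee_mulE.
by apply/pres_classP; apply: (pres_inv _ (false, o)).
Qed.

(** The upper bound on the presented group: inverse letters are eliminated with
    [(g i)^-1 = z * g i], then [gprod_canonical] applies. *)
Lemma vee_canonical (x : vee n) :
  exists e S, x = zv ^+ e * gprod gv (enum (S : {set 'I_n})).
Proof.
have Vv := vee_family_vee.
suff [e [s ->]]: exists e s, x = zv ^+ e * gprod gv s.
  have [f ->] := gprod_canonical Vv s.
  by exists (e + f), (odd_support s); rewrite mulgA expgnDr.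
elim/pres_ind: x => w; rewrite vee_class_letters.
elim: w => [|[b [i|]] w [e [s IHw]]].
- by exists 0, [::]; rewrite /gprod !big_nil mul1g.
- rewrite big_cons IHw /= mulgA; exists (b + e), (i :: s).
  rewrite gprod_cons mulgA expgnDr; congr (_ * _).
  case: b => /=; rewrite ?(fam_gV Vv) ?mul1g -?mulgA; last first.
    by rewrite (commuteX e (commute_sym (fam_zC Vv i))).
  by rewrite -(commuteX e (commute_sym (fam_zC Vv i))).
rewrite big_cons IHw /=; exists e.+1, s; rewrite expgS -mulgA; congr (_ * _).
by case: b => //; rewrite (fam_zV Vv).
Qed.

Variables (gT : finGroupType) (z : gT) (g : 'I_n -> gT).
Hypothesis gV : vee_family (gT := gT) z g.
Hypothesis z1 : z != 1.
(* No product over a nonempty set of generators is a sign: this is what makes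
   the canonical forms in [gT] distinct. *)
Hypothesis g_free :
  forall e (S : {set 'I_n}),
    gprod (gT := gT) g (enum S) = z ^+ e -> S = set0.

Definition letter_val : option 'I_n -> gT := oapp g z.
Definition word_val (w : word (option 'I_n)) : gT :=
  \prod_(l <- w) (if l.1 then (letter_val l.2)^-1 else letter_val l.2).

Lemma word_val_pres u w : pres_eq (@vee_rel n) u w -> word_val u = word_val w.
Proof.
rewrite /word_val; elim=> {u w}.
- move=> u w [|i|i j ne_ij|i]; rewrite unlock /= !mulg1.
  + exact: fam_zz gV.
  + exact: (fam_gg gV i).
  + exact: (fam_gC gV ne_ij).
  + exact: (fam_zC gV i).
- by case=> [[] o]; rewrite unlock /= mulg1 ?mulgV ?mulVg.
- by move=> u w u' w' _ IHu _ IHu'; rewrite !big_cat /= IHu IHu'.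
- by [].
- by move=> u w _ ->.
- by move=> u v w _ -> _ ->.
Qed.

(** The homomorphism given by the universal property of the presentation. It is
    computed on a chosen word; the choice is irrelevant by [vee_evalE]. *)
Definition vee_eval (x : vee n) : gT := word_val (generic_quotient.repr x).

Lemma vee_evalE w : vee_eval (pres_class (@vee_rel n) w) = word_val w.
Proof. exact/word_val_pres/pres_repr. Qed.

Lemma vee_evalM : {morph vee_eval : x y / x * y}.
Proof.
elim/pres_ind=> u; elim/pres_ind=> w; rewrite vee_mulE !vee_evalE.
exact: big_cat.
Qed.

Lemma vee_eval1 : vee_eval 1 = 1.
Proof. by rewrite -vee_one vee_evalE /word_val big_nil. Qed.

Lemma vee_eval_canonical e s :
  vee_eval (zv ^+ e * gprod gv s) = z ^+ e * gprod (gT := gT) g s.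
Proof.
rewrite vee_evalM; congr (_ * _).
  elim: e => [|e IHe]; first exact: vee_eval1.
  by rewrite !expgS vee_evalM IHe vee_evalE /word_val unlock /= mulg1.
elim: s => [|i s IHs]; first by rewrite /gprod !big_nil vee_eval1.
by rewrite !gprod_cons vee_evalM IHs vee_evalE /word_val unlock /= mulg1.
Qed.

(** A canonical form in the kernel has empty index set by [g_free], so it is a
    power of -1, and it is trivial because [z != 1]. *)
Lemma vee_eval_inj : injective vee_eval.
Proof.
have Vv := vee_family_vee.
suff ker1 x : vee_eval x = 1 -> x = 1.
  move=> x y fxy; apply: (mulIg y^-1); rewrite mulgV; apply: ker1.
  by rewrite vee_evalM fxy -vee_evalM mulgV vee_eval1.
have [e [S ->]] := vee_canonical x; rewrite vee_eval_canonical => fx1.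
have S0 : S = set0.
  apply: (g_free (e := e)); apply: (mulgI (z ^+ e)); rewrite fx1.
  by rewrite -{1}(fam_zXV gV e) mulVg.
move: fx1; rewrite S0 enum_set0 /gprod !big_nil !mulg1.
rewrite (fam_zX_odd gV) (fam_zX_odd Vv).
by case: odd => //=; rewrite !expg1 => z_1; move: z1; rewrite z_1 eqxx.
Qed.

Variable L : {group gT}.
Hypothesis defL : L :=: <<z |: [set g i | i : 'I_n]>>.

Lemma vee_isom : isomorphic_to (vee n) L.
Proof.
exists vee_eval; split=> [||y]; [exact: vee_evalM | exact: vee_eval_inj |].
split=> [|[x <-]].
  rewrite defL => /gen_prodgP[m [c cA ->]].
  have pre i : exists x, vee_eval x = c i.
    have /setU1P[->|/imsetP[j _ ->]] := cA i; [exists zv | exists (gv j)];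
    by rewrite vee_evalE /word_val unlock /= mulg1.
  elim/big_rec: _ => [|i _ _ [x <-]].
    by exists (1 : vee n); rewrite vee_eval1.
  by have [x' <-] := pre i; exists (x' * x); rewrite vee_evalM.
elim/pres_ind: x => w; rewrite vee_evalE; apply: group_prod => -[b o] _.
have Lo : letter_val o \in L.
  rewrite defL mem_gen //; case: o => [i|] /=; last exact: setU11.
  by rewrite setU1r // imset_f.
by case: b; rewrite ?groupV.
Qed.

(** Signs and subsets of indices parametrise the group bijectively. If the
    products over [S] and [T] agree up to sign, then the concatenation of their
    enumerations is a sign, and its odd support is the symmetric difference of
    [S] and [T], empty by [g_free]. *)
Lemma card_vee_family : #|L| = (2 ^ n.+1)%N.
Proof.
pose h (bS : bool * {set 'I_n}) := z ^+ bS.1 * gprod (gT := gT) g (enum bS.2).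
have Dh : L = h @: setT :> {set gT}.
  have [f [_ _ fL]] := vee_isom.
  apply/setP=> y; apply/idP/imsetP=> [|[[b S] _ ->]].
    rewrite {1}defL => /gen_prodgP[m [c cA ->]].
    suff [e [s ->]]: exists e s, \prod_i c i = z ^+ e * gprod (gT := gT) g s.
      have [f' ->] := gprod_canonical gV s.
      exists (odd (e + f'), odd_support s) => //.
      by rewrite /h /= -(fam_zX_odd gV) expgnDr mulgA.
    elim/big_rec: _ => [|i x _ [e [s ->]]].
      by exists 0, [::]; rewrite /gprod big_nil mulg1.
    have /setU1P[->|/imsetP[j _ ->]] := cA i.
      by exists e.+1, s; rewrite expgS mulgA.
    exists e, (j :: s); rewrite gprod_cons !mulgA; congr (_ * _).
    exact: (commuteX e (commute_sym (fam_zC gV j))).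
  have Lz : z \in L by rewrite defL mem_gen ?setU11.
  rewrite groupM ?groupX //; apply: group_prod => i _.
  by rewrite defL mem_gen // setU1r ?imset_f.
rewrite Dh card_imset.
  rewrite cardsT card_prod card_bool -[#|{set _}|]cardsT -powersetT.
  by rewrite card_powerset cardsT card_ord expnS.
move=> [b S] [c T]; rewrite /h /= => eST.
have ST : gprod (gT := gT) g (enum S) =
          z ^+ (b + c) * gprod (gT := gT) g (enum T).
  apply: (mulgI (z ^+ b)).
  by rewrite eST expgnDr !mulgA -{2}(fam_zXV gV b) mulgV mul1g.
have [e def_TT] : exists e, gprod (gT := gT) g (enum T ++ enum T) = z ^+ e.
  have [e ->] := gprod_canonical gV (enum T ++ enum T); exists e.
  have -> : odd_support (enum T ++ enum T) = set0.
    by apply/setP=> i; rewrite !inE count_cat addnn odd_double.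
  by rewrite enum_set0 /gprod big_nil mulg1.
have [f def_ST] := gprod_canonical gV (enum S ++ enum T).
have S_T : S = T.
  have: odd_support (enum S ++ enum T) = set0.
    apply: (g_free (e := f + (b + c + e))); apply: (mulgI (z ^+ f)).
    rewrite -def_ST gprod_cat ST -mulgA -gprod_cat def_TT -!expgnDr.
    rewrite (addnA f f) [RHS](fam_zX_odd gV) oddD addnn odd_double.
    by rewrite [LHS](fam_zX_odd gV).
  move/setP=> eST'; apply/setP=> i; have := eST' i; rewrite !inE count_cat.
  rewrite !count_uniq_mem ?enum_uniq // !mem_enum oddD.
  by case: (i \in S); case: (i \in T).
rewrite S_T in eST *; congr (_, _); move/mulIg: eST => {ST}.
by case: b; case: c => //= /eqP; rewrite ?(eq_sym 1) expg1 (negPf z1).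
Qed.

End Presentation.
End VeeFamilies.

(** * Signed steps along the edges of an Adinkra *)

Section SignedSteps.
Local Open Scope group_scope.

Section Neg.
Variable T : finType.

Definition neg_fun (u : bool * T) : bool * T := (~~ u.1, u.2).

Lemma neg_funK : involutive neg_fun.
Proof. by case=> b x; rewrite /neg_fun /= negbK. Qed.

Definition neg : {perm bool * T} := perm (can_inj neg_funK).

Lemma negE u : neg u = (~~ u.1, u.2).
Proof. by rewrite permE. Qed.

Lemma neg_neg : neg * neg = 1.
Proof. by apply/permP=> u; rewrite permM perm1 !negE negbK; case: u. Qed.

End Neg.

Variables (N : nat) (A : adinkra N).
Implicit Types (i k : 'I_N) (j l : 'I_N.-1) (x y : vertex A).

Definition signed_step_fun i (u : bool * vertex A) : bool * vertex A :=
  (u.1 (+) dashed u.2 (nbr i u.2), nbr i u.2).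

Lemma signed_step_funK i : involutive (signed_step_fun i).
Proof.
case=> b x; rewrite /signed_step_fun /= nbrK -(dashed_sym (nbrP i x)).
by rewrite -addbA addbb addbF.
Qed.

Definition signed_step i : {perm bool * vertex A} :=
  perm (can_inj (@signed_step_funK i)).

Lemma signed_stepE i u :
  signed_step i u = (u.1 (+) dashed u.2 (nbr i u.2), nbr i u.2).
Proof. by rewrite permE. Qed.

Lemma signed_step_sq i : signed_step i * signed_step i = 1.
Proof. by apply/permP=> u; rewrite permM perm1 !permE signed_step_funK. Qed.

Lemma neg_signed_step i : commute (neg _) (signed_step i).
Proof.
by apply/permP=> -[b x]; rewrite !permM !negE !signed_stepE /= addNb.
Qed.

(** Odd dashing: the two ways round a 2-coloured 4-cycle from [x] to the
    opposite vertex have different numbers of dashed edges modulo 2. *)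
Lemma signed_stepC i k : i != k ->
  signed_step i * signed_step k = neg _ * (signed_step k * signed_step i).
Proof.
move=> ne_ik; apply/permP=> -[b x]; rewrite !permM !negE !signed_stepE /= nbrC.
congr (_, _).
have e3 : edge i (nbr k (nbr i x)) (nbr k x).
  by rewrite nbrC edge_sym nbrP.
have e4 : edge k (nbr k x) x by rewrite edge_sym nbrP.
have := odd_dashing ne_ik (nbrP i x) (nbrP k (nbr i x)) e3 e4.
rewrite (dashed_sym e3) (dashed_sym e4) [nbr k (nbr i x)]nbrC !oddD !oddb.
by case: b; do 4 case: dashed.
Qed.

(** Both sides reduce by [(a k)(b k) = - a (k k) b = - a b], and the steps
    [i] and [i'] anticommute. *)
Lemma signed_bistepC i i' k : i != i' -> k != i -> k != i' ->
  (signed_step i * signed_step k) * (signed_step i' * signed_step k) =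
  neg _ * ((signed_step i' * signed_step k) * (signed_step i * signed_step k)).
Proof.
have red a b : k != b ->
    (signed_step a * signed_step k) * (signed_step b * signed_step k) =
    neg _ * (signed_step a * signed_step b).
  move=> ne_kb; rewrite !mulgA -[_ * _ * signed_step b]mulgA signed_stepC //.
  by rewrite !mulgA -neg_signed_step -!mulgA signed_step_sq mulg1.
by move=> ne_ii' ne_ki ne_ki'; rewrite !red // signed_stepC.
Qed.

(** A single step exchanges bosons and fermions, so the relations between the
    [zeta j] are proved for permutations of all signed vertices and pulled back
    along this inclusion. *)
Definition fermion_incl (u : pm_fermion A) : bool * vertex A := (u.1, val u.2).

Lemma fermion_incl_inj : injective fermion_incl.
Proof. by move=> [b x] [c y] [-> /val_inj->]. Qed.

Lemma fermion_incl_zeta j u :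
  fermion_incl (zeta A j u) =
  (signed_step (next_colour j) * signed_step (first_colour j)) (fermion_incl u).
Proof.
rewrite permM !signed_stepE /zeta permE /zeta_fun /fermion_incl /sigma permE /=.
by rewrite /num_dashed oddD !oddb addbA.
Qed.

Lemma fermion_incl_neg u : fermion_incl (neg _ u) = neg _ (fermion_incl u).
Proof. by rewrite !negE. Qed.

Lemma zeta_vee_family :
  vee_family (gT := {perm pm_fermion A}) (neg (fermion A)) (zeta A).
Proof.
have ne_nf j l : first_colour j != next_colour l by [].
split=> [|j|j l ne_jl|j]; first exact: neg_neg.
- apply/permP=> u; apply: fermion_incl_inj.
  rewrite permM !fermion_incl_zeta fermion_incl_neg -!permM; congr (aperm _ _).
  rewrite !mulgA -[_ * _ * signed_step (next_colour j)]mulgA.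
  rewrite signed_stepC ?ne_nf //.
  rewrite !mulgA -neg_signed_step -!mulgA.
  by rewrite signed_step_sq mulg1 signed_step_sq mulg1.
- apply/permP=> u; apply: fermion_incl_inj.
  rewrite !permM !fermion_incl_zeta fermion_incl_neg -!permM.
  have -> : first_colour l = first_colour j by apply: val_inj.
  by rewrite -mulgA; congr (aperm _ _); rewrite mulgA; apply: signed_bistepC.
apply/permP=> u; apply: fermion_incl_inj.
rewrite !permM !fermion_incl_zeta !fermion_incl_neg fermion_incl_zeta -!permM.
congr (aperm _ _); rewrite mulgA neg_signed_step -mulgA neg_signed_step mulgA.
by [].
Qed.

Lemma gprod_zeta_snd s u :
  (gprod (gT := {perm pm_fermion A}) (zeta A) s u).2 =
  gprod (gT := {perm fermion A}) (sigma A) s u.2.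
Proof.
elim: s u => [|j s IHs] u; first by rewrite /gprod !big_nil !perm1.
by rewrite !gprod_cons !permM IHs permE.
Qed.

Lemma negX_snd e u : ((neg (fermion A) ^+ e) u).2 = u.2.
Proof.
elim: e u => [|e IHe] u; first by rewrite perm1.
by rewrite expgS permM IHe negE.
Qed.

End SignedSteps.

(** * Walks, the code and the monodromy group *)

Section Walks.
Import GRing.Theory FinRing.Theory.
Local Open Scope group_scope.
Variables (N : nat) (A : adinkra N).
Implicit Types (i : 'I_N) (x y v : vertex A) (u w : 'rV['F_2]_N).
Local Notation h1 := (const_mx 1%R : 'rV['F_2]_N).

Lemma walk_delta i : walk A (delta_mx 0%R i) = step A i.
Proof.
transitivity (\prod_(k | k == i) step A k); last exact: big_pred1_eq.
rewrite big_mkcond.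
by apply: eq_bigr => k _; rewrite mxE eqxx /=; case: (k == i).
Qed.

Lemma walkC u w : commute (walk A u) (walk A w).
Proof. by rewrite /commute -!walkM !zmodMgE addrC. Qed.

Lemma walk_trans x y : connected A -> exists u, walk A u x = y.
Proof.
move=> /(_ x y)/connectP[p]; elim: p x => [|z p IHp] x /=.
  by move=> _ ->; exists 1; rewrite walk1 perm1.
case/andP=> /existsP[i /nbr_eq def_z] /IHp{}IHp /IHp[u <-].
exists (delta_mx 0%R i * u); rewrite walkM permM walk_delta.
by rewrite -def_z permE.
Qed.

(** The cube acts through commuting permutations and transitively, so all
    vertices have the same stabiliser. *)
Lemma walk_fix u x y : connected A -> walk A u x = x -> walk A u y = y.
Proof.
move=> cA ux; have [w <-] := walk_trans x y cA.
by rewrite -permM -walkC permM ux.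
Qed.

Lemma mem_code_walk v u : (u \in code v) = (walk A u v == v).
Proof. by rewrite mem_code; apply/astab1P/eqP. Qed.

Lemma walk_all_ones : walk A h1 = \prod_(i < N) step A i.
Proof. by apply: eq_bigr => i _; rewrite mxE expg1. Qed.

Lemma boson_steps (s : seq 'I_N) x :
  boson ((\prod_(i <- s) step A i) x) = odd (size s) (+) boson x.
Proof.
elim: s x => [|i s IHs] x; first by rewrite big_nil perm1.
by rewrite big_cons permM IHs permE boson_nbr /= addbN addNb.
Qed.

(** A walk along the word of all ones has length [N], and each step exchanges
    bosons and fermions. *)
Lemma all_ones_code_even v : h1 \in code v -> ~~ odd N.
Proof.
rewrite mem_code_walk walk_all_ones => /eqP/(congr1 (@boson _ _)).
rewrite boson_steps.
have -> : size (index_enum 'I_N) = N.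
  by rewrite -[RHS]card_ord cardT enumT /index_enum unlock.
by case: odd; case: boson.
Qed.

Lemma card_vspace_F2 n (V : {vspace 'rV['F_2]_n}) : #|V| = (2 ^ \dim V)%N.
Proof.
pose f (u : 'rV['F_2]_(\dim V)) : 'rV['F_2]_n :=
  (\sum_i u ord0 i *: (vbasis V)`_i)%R.
have f_inj : injective f.
  move=> u w fuw; apply/rowP=> i.
  by rewrite -!(coord_sum_free _ _ (basis_free (vbasisP V))) -/(f u) fuw.
have <- : #|f @: setT| = #|V|; last first.
  by rewrite card_imset // cardsT card_mx mul1n card_Fp.
apply: eq_card => x.
apply/imsetP/idP => [[u _ ->]|Vx].
  apply: memv_suml => i _.
  by rewrite memvZ // vbasis_mem // mem_nth ?size_tuple.
exists (\row_i coord (vbasis V) i x)%R => //.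
by rewrite {1}(coord_vbasis Vx); apply: eq_bigr => i _; rewrite mxE.
Qed.

(** Orbit-stabiliser for the cube acting on the vertices. *)
Lemma card_vertex v : connected A ->
  (#|vertex A| * 2 ^ \dim (code v) = 2 ^ N)%N.
Proof.
move=> cA; have := card_orbit_stab (cube_action A) [set: 'rV['F_2]_N]%G v.
have -> : orbit (cube_action A) [set: 'rV['F_2]_N]%G v = setT.
  apply/setP=> y; rewrite inE; have [u <-] := walk_trans v y cA.
  by apply/orbitP; exists u; rewrite ?inE.
rewrite setTI -(eq_card (mem_code v)) card_vspace_F2 => eN.
by rewrite cardsT in eN; rewrite eN cardsT card_mx mul1n card_Fp.
Qed.

Lemma card_fermion i : #|vertex A| = (2 * #|fermion A|)%N.
Proof.
rewrite card_sig -(cardC (boson (a := A))) mul2n -addnn; congr (_ + _)%N.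
rewrite -(card_image (@can_inj _ _ _ _ (@nbrK _ A i)) (boson (a := A))).
apply: eq_card => x; apply/imageP/idP=> [[y by_ ->]|bx].
  by rewrite !unfold_in boson_nbr negbK.
exists (nbr i x); last by rewrite nbrK.
by rewrite -[_ \in _]/(boson (nbr i x)) boson_nbr.
Qed.

Lemma fermion_exists i v : inhabited (fermion A).
Proof.
case bv: (boson v); last exact/inhabits/(exist _ v (negbT bv)).
by apply/inhabits; exists (nbr i v); rewrite boson_nbr bv.
Qed.

Lemma sigmaC j l : commute (sigma A j) (sigma A l).
Proof.
apply/permP=> x; apply: val_inj; rewrite !permM !permE /=.
have -> : first_colour l = first_colour j by apply: val_inj.
by rewrite ![nbr (next_colour _) (nbr (first_colour _) _)]nbrC
           [nbr (next_colour l) _]nbrC.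
Qed.

(** Along a path in the graph, each vertex is either the image of [x] under the
    monodromy or the neighbour of such an image along colour 0. This invariant
    is preserved by a step of colour 0, and by a step of colour [j + 1] because
    it differs from [sigma j] by a step of colour 0. *)
Lemma monodromy_trans (x y : fermion A) : connected A ->
  exists2 m, m \in monodromy A & m x = y.
Proof.
move=> cA.
pose near (z : vertex A) := exists2 m, m \in monodromy A &
  z = val (m x) \/ exists2 i : 'I_N, val i = 0%N & z = nbr i (val (m x)).
suff [m Mm [/val_inj->|[i _ def_y]]] : near (val y); first by exists m.
  by have := valP y; rewrite def_y boson_nbr (valP (m x)).
have: near (val x) by exists 1; rewrite ?group1 ?perm1; last left.
case/connectP: (cA (val x) (val y)) => p + ->; elim: p (val x) => //= z p IHp z0.
case/andP=> /existsP[i /nbr_eq <-] /IHp{}IHp near_z0; apply: IHp.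
have [i0|i_gt0] := posnP i.
  case: near_z0 => m Mm [->|[i' i'0 ->]]; exists m => //.
    by right; exists i.
  left; have -> : i = i' by apply: val_inj; rewrite /= i0 i'0.
  by rewrite nbrK.
have lt_j : i.-1 < N.-1 by rewrite -ltnS !prednK ?(leq_ltn_trans _ (ltn_ord i)).
pose j := Ordinal lt_j.
have def_i : i = next_colour j by apply: val_inj; rewrite /= prednK.
have Msj : sigma A j \in monodromy A by rewrite mem_gen ?imset_f.
case: near_z0 => m Mm [->|[i' i'0 ->]]; exists (m * sigma A j); rewrite ?groupM //.
  right; exists (first_colour j) => //.
  by rewrite permM [sigma A j _]permE /= nbrK def_i.
left; have -> : i' = first_colour j by apply: val_inj.
by rewrite permM [sigma A j _]permE /= nbrC def_i.
Qed.

Lemma monodromy_abelian : abelian (monodromy A).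
Proof.
rewrite abelian_gen; apply/centsP=> _ /imsetP[j _ ->] _ /imsetP[l _ ->].
exact: sigmaC.
Qed.

(** A transitive abelian permutation group is regular: evaluation at [x] is a
    bijection from the group to the fermions. *)
Lemma card_monodromy (x : fermion A) : connected A ->
  #|monodromy A| = #|fermion A|.
Proof.
move=> cA; rewrite -(card_in_imset (f := fun m : {perm fermion A} => m x)).
  rewrite -cardsT; apply: eq_card => y; rewrite inE; apply/imsetP.
  by have [m Mm <-] := monodromy_trans x y cA; exists m.
move=> m m' Mm Mm' /= mx; apply/permP=> y.
have [a Ma <-] := monodromy_trans x y cA.
have cM := centsP monodromy_abelian.
by rewrite -!permM (cM _ Ma _ Mm) (cM _ Ma _ Mm') !permM mx.
Qed.

Lemma abs_kernelP f : f \in abs_kernel A ->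
  forall p : pm_fermion A, f p = (p.1 (+) (f (false, p.2)).1, p.2).
Proof.
case/setIP=> Hf /kerP ker_f.
have Sf := subsetP (signed_monodromy_sub A) f Hf.
have f0 (x : fermion A) : f (false, x) = ((f (false, x)).1, x).
  have: abs f x = x by rewrite -[abs f]/(abs_morphism A f) ker_f ?perm1.
  by rewrite absE // => {3}<-; case: (f _).
move/signed_permP: Sf => Sf [[] x]; last by rewrite {1}f0.
by rewrite -[(true, x)]/(pm_opp ((false, x) : pm_fermion A)) Sf {1}f0.
Qed.

Lemma abs_kernel_abelem : 2.-abelem (abs_kernel A).
Proof.
apply/abelemP=> //; split=> [|f Kf].
  apply/centsP=> f /abs_kernelP Kf g /abs_kernelP Kg; apply/permP=> u.
  rewrite !permM Kg [f u]Kf [RHS]Kf [g u]Kg /=.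
  by rewrite -!addbA; congr (_ (+) _, _); rewrite addbC.
have {}Kf := abs_kernelP Kf; apply/permP=> u.
by rewrite expg2 permM perm1 Kf [f u]Kf /= -addbA addbb addbF; case: u.
Qed.

Lemma card_abs_kernel :
  (#|abs_kernel A| * #|monodromy A|)%N = #|signed_monodromy A|.
Proof.
rewrite -(abs_signed_monodromy A) card_morphim.
by rewrite (setIidPr (signed_monodromy_sub A)) LagrangeI.
Qed.

(** Since [2 * #|M| * 2 ^ k = 2 ^ N], with [M] the monodromy group and [k] the
    dimension of the code, a signed monodromy group of order [2 ^ (N + d - 1)]
    leaves order [2 ^ (k + d)] for the kernel of [abs], and an elementary
    abelian group is determined by its order. *)
Lemma abs_kernel_isog v d : 0 < N -> connected A ->
  (#|signed_monodromy A| * 2 = 2 ^ (N + d))%N ->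
  abs_kernel A \isog [set: 'rV['F_2]_(\dim (code v) + d)].
Proof.
move=> N_gt0 cA cardH; pose i := Ordinal N_gt0.
rewrite (isog_abelem_card _ abs_kernel_abelem) mx_Fp_abelem //=.
rewrite cardsT card_mx mul1n card_Fp // eq_sym.
have [x] := fermion_exists i v.
have cV := card_vertex v cA.
rewrite (card_fermion i) -(card_monodromy x cA) in cV.
rewrite -card_abs_kernel expnD -cV in cardH.
have M_gt0 := cardG_gt0 (monodromy A).
rewrite -(eqn_pmul2r (m := 2 * #|monodromy A|)) ?muln_gt0 //.
apply/eqP; rewrite expnD [in LHS](mulnC 2) mulnA cardH.
by rewrite [RHS]mulnC mulnA.
Qed.

End Walks.

(** * The signed monodromy group *)

Section SignedMonodromy.
Import GRing.Theory.
Local Open Scope group_scope.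
Variables (n : nat) (A : adinkra n.+2).
Hypothesis cA : connected A.
Implicit Types (j l : 'I_n.+1) (x y v : vertex A).
Local Notation h1 := (const_mx 1%R : 'rV['F_2]_n.+2).
Local Notation zeta := (zeta A : 'I_n.+1 -> {perm pm_fermion A}).
Local Notation sigma := (sigma A : 'I_n.+1 -> {perm fermion A}).
Local Notation z := (neg (fermion A)).
Local Notation H := (signed_monodromy A).

Let zetaV : vee_family (gT := {perm pm_fermion A}) z zeta := zeta_vee_family A.

(** The product follows each colour other than 0 once and colour 0 as many
    times as there are factors, an odd number; steps commute and are
    involutions. *)
Lemma gprod_sigma_walk (x : fermion A) : odd n.+1 ->
  val (gprod (gT := {perm fermion A}) sigma (enum 'I_n.+1) x) =
  walk A h1 (val x).
Proof.
move=> odd_n; rewrite walk_all_ones big_ord_recl.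
have bistep s (y : fermion A) : val (gprod (gT := {perm fermion A}) sigma s y) =
    (\prod_(j <- s) (step A (lift ord0 j) * step A ord0)) (val y).
  elim: s y => [|j s IHs] y; first by rewrite /gprod !big_nil !perm1.
  rewrite gprod_cons big_cons !permM IHs; congr (aperm _ _).
  rewrite [sigma j y]permE !permE /=.
  by congr (nbr _ (nbr _ _)); apply: val_inj.
rewrite bistep prodgM_commute; last by move=> j l _ _; apply: stepC.
rewrite big_const_seq count_predT size_enum_ord.
rewrite iter_mulg_1 -[_ ^+ n.+1](expg_mod _ (step2 A ord0)) modn2 odd_n expg1.
rewrite commute_sym //; last by apply: commute_prod => j _; apply: stepC.
by rewrite enumT /index_enum unlock.
Qed.

Lemma all_ones_code_fermion v (x : fermion A) :
  (h1 \in code v) = (walk A h1 (val x) == val x).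
Proof. by rewrite mem_code_walk; apply/eqP/eqP=> /(walk_fix _ cA); apply. Qed.

Lemma neg_neq1 (x : fermion A) : z != 1.
Proof. by apply/eqP=> /permP/(_ (false, x)); rewrite negE perm1. Qed.

Lemma signed_monodromy_neg : z \in H.
Proof.
by rewrite -(fam_gg zetaV ord0); apply: groupM; apply: mem_gen; apply: imset_f.
Qed.

(** A permutation that commutes with the signed monodromy and sends [x] to
    [+x] or [-x] is determined by this one sign, because the signed monodromy
    is transitive on signed fermions. *)
Lemma signed_monodromy_cent (f : {perm pm_fermion A}) (x : fermion A) :
  f \in 'C(H) -> (f (false, x)).2 = x -> exists e, f = z ^+ e.
Proof.
move=> /centP cf fx; pose b := (f (false, x)).1.
have Hz := signed_monodromy_neg.
suff fb1 : f * z ^+ b = 1.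
  by exists b; rewrite -(fam_zXV zetaV b) -(mulg1_eq fb1) invgK.
have cg : forall h, h \in H -> commute (f * z ^+ b) h.
  move=> h Hh; apply/commute_sym/commuteM; first exact/commute_sym/cf.
  apply: commuteX; have: H \subset 'C[z].
    rewrite gen_subG; apply/subsetP=> _ /imsetP[j _ ->]; apply/cent1P.
    exact/commute_sym/(fam_zC zetaV j).
  by move/subsetP/(_ h Hh)/cent1P.
have gx : (f * z ^+ b) (false, x) = (false, x).
  rewrite permM [f _]surjective_pairing fx -/b.
  by case: (b); rewrite ?perm1 // expg1 negE.
have fixes (h : {perm pm_fermion A}) : h \in H ->
    (f * z ^+ b) (h (false, x)) = h (false, x).
  by move=> Hh; rewrite -permM -cg // permM gx.
apply/permP=> -[c y]; rewrite perm1.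
have [m + <-] := monodromy_trans x y cA; rewrite -(abs_signed_monodromy A).
case/morphimP=> h Sh Hh ->; rewrite [abs_morphism A h]/= absE //.
(* [h] sends [x] to [y] up to sign; if the sign is wrong, use [h * z]. *)
have [<-|ne_c] := eqVneq (h (false, x)).1 c.
  by rewrite -surjective_pairing fixes.
have -> : (c, (h (false, x)).2) = (h * z) (false, x).
  by rewrite permM negE; case: c ne_c; case: (h _) => -[].
by rewrite fixes ?groupM.
Qed.

(** A sign among the products of generators would be the product of all of
    them, an odd number, and would make the word of all ones fix a fermion. *)
Lemma signed_monodromy_all_ones_notin v : h1 \notin code v ->
  isomorphic_to (vee n.+1) H /\ #|H| = (2 ^ n.+2)%N.
Proof.
move=> Ch1; have [x] := fermion_exists ord0 v.
have free e (S : {set 'I_n.+1}) :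
    gprod (gT := {perm pm_fermion A}) zeta (enum S) = z ^+ e -> S = set0.
  move=> eS; have [//|[]] := gprod_central zetaV (neg_neq1 x) eS.
  move=> odd_n defS; case/negP: Ch1.
  rewrite (all_ones_code_fermion _ x) -gprod_sigma_walk.
    rewrite -[x]/((false, x) : pm_fermion A).2 -gprod_zeta_snd.
    rewrite (_ : enum _ = enum S) ?eS ?negX_snd //.
    by apply: eq_enum => j; rewrite defS !inE.
  by rewrite defS cardsT card_ord in odd_n.
have defH : H :=: <<z |: [set zeta j | j : 'I_n.+1]>>.
  apply/eqP; rewrite eqEsubset genS ?subsetUr //= gen_subG.
  rewrite subUset sub1set signed_monodromy_neg; apply/subsetP=> f.
  exact: mem_gen.
split; first exact: (vee_isom zetaV (neg_neq1 x) free defH).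
exact: (card_vee_family zetaV (neg_neq1 x) free defH).
Qed.

(** The product of all generators moves no fermion and is central, because
    their number is odd; hence it is a sign, and the generator [zeta ord0] can
    be recovered from the others. *)
Lemma signed_monodromy_all_ones_in v : h1 \in code v ->
  isomorphic_to (vee n) H /\ #|H| = (2 ^ n.+1)%N.
Proof.
move=> Ch1; have [x] := fermion_exists ord0 v.
have /= := all_ones_code_even Ch1; rewrite negbK => even_n.
pose P := gprod (gT := {perm pm_fermion A}) zeta (enum 'I_n.+1).
have [e defP] : exists e, P = z ^+ e.
  (* By [gprodC], moving [zeta j] through the product costs [n] signs, and [n]
     is even. *)
  apply: (@signed_monodromy_cent _ x).
    rewrite cent_gen; apply/centP=> _ /imsetP[j _ ->]; apply/commute_sym.
    rewrite /commute (gprodC zetaV) (fam_zX_odd zetaV).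
    have := count_predC (pred1 j) (enum 'I_n.+1).
    rewrite count_uniq_mem ?enum_uniq // mem_enum size_enum_ord add1n => -[->].
    by rewrite (negPf even_n) expg0 mul1g.
  rewrite gprod_zeta_snd; apply: val_inj; rewrite gprod_sigma_walk //=.
  by apply/eqP; rewrite -(all_ones_code_fermion v).
pose g (j : 'I_n) := zeta (lift ord0 j).
have gV : vee_family (gT := {perm pm_fermion A}) z g.
  split=> [|j|j l ne_jl|j]; [exact: (fam_zz zetaV)|exact: (fam_gg zetaV)| |].
    by apply: (fam_gC zetaV); rewrite (inj_eq lift_inj).
  exact: (fam_zC zetaV).
have free f (S : {set 'I_n}) :
    gprod (gT := {perm pm_fermion A}) g (enum S) = z ^+ f -> S = set0.
  move=> eS; have [//|[+ defS]] := gprod_central gV (neg_neq1 x) eS.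
  by rewrite defS cardsT card_ord (negPf even_n).
have defH : H :=: <<z |: [set g j | j : 'I_n]>>.
  apply/eqP; rewrite eqEsubset !gen_subG; apply/andP; split.
    have Lz : z \in <<z |: [set g j | j : 'I_n]>> by rewrite mem_gen ?setU11.
    have Lg (j : 'I_n) : g j \in <<z |: [set g j | j : 'I_n]>>.
      by rewrite mem_gen // setU1r ?imset_f.
    apply/subsetP=> _ /imsetP[j _ ->].
    case: (unliftP ord0 j) => [k ->|->]; first exact: Lg.
    move: defP; rewrite /P enum_ordSl gprod_cons /gprod big_map => defP.
    rewrite -(@groupMr _ _ (\prod_(j <- enum 'I_n) g j)).
      by rewrite [_ * _]defP groupX.
    by apply: group_prod => k _; apply: Lg.
  rewrite subUset sub1set signed_monodromy_neg.
  by apply/subsetP=> _ /imsetP[j _ ->]; apply: mem_gen; apply: imset_f.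
split; first exact: (vee_isom gV (neg_neq1 x) free defH).
exact: (card_vee_family gV (neg_neq1 x) free defH).
Qed.

End SignedMonodromy.

Theorem theorem6p1 (N : nat) (A : adinkra N) (v : vertex A) :
  1 < N -> connected A ->
  let C := code v in
  let k := (\dim C)%VS in
  let h1 : 'rV['F_2]_N := const_mx 1%R in
  (h1 \notin C ->
     isomorphic_to (vee (N - 1)) (signed_monodromy A) /\
     (abs_kernel A \isog [set: 'rV['F_2]_(k + 1)])%g) /\
  (h1 \in C ->
     isomorphic_to (vee (N - 2)) (signed_monodromy A) /\
     (abs_kernel A \isog [set: 'rV['F_2]_k])%g).
Proof.
case: N A v => [|[|n]] // A v _ cA /=; rewrite subn1 subn2 /=.
split=> [Ch1 | Ch1].
  have [isoH cardH] := signed_monodromy_all_ones_notin cA Ch1; split=> //.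
  by apply: abs_kernel_isog => //; rewrite cardH -expnSr addn1.
have [isoH cardH] := signed_monodromy_all_ones_in cA Ch1; split=> //.
have := @abs_kernel_isog _ A v 0 isT cA.
by rewrite cardH -expnSr !addn0; apply.
Qed.
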